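(* Let $s_0$ be an initial symbolic configuration for a program $P$. If the symbolic evaluation gets stuck in a configuration $s_k$, then $P$ is not constant-time. Formally, if there exists $k$ such that $s_0 \rightsquigarrow^k s_k$ and $s_k$ is stuck, then there exist a model $M$ and concrete configurations $c_0 \approx_l^M s_0$, $c_0' \approx_r^M s_0$, $c_k \approx_l^M s_k$ and $c_k' \approx_r^M s_k$ such that, for some concrete configurations $c_{k+1},c_{k+1}'$ and leakages $t,t',u,u'$, $$ c_0 \simeq_L c_0' \ \wedge\ c_0 \to_t^k c_k \to_u c_{k+1} \ \wedge\ c_0' \to_{t'}^k c_k' \to_{u'} c_{k+1}' \ \wedge\ t\cdot u \neq t'\cdot u' .$$
   Context: **Programs.** $BV_n=\{0,1\}^n$ is the set of $n$-bit words. $Var$ is a set of variables (registers) and $Loc$ the set of program locations; $l+1$ is the location following $l$. $to\_loc: BV_{32}\to Loc$ converts a bitvector to a location. Expressions: $e ::= v \mid bv \mid @e \mid \diamond_u e \mid e\,\diamond_b\, e$, where $v\in Var$, $bv$ is a bitvector value, $@e$ is a memory read, and $\diamond_u,\diamond_b$ are unary/binary operators. Instructions: $v:=e$; $@e:=e'$ (memory write); $\mathtt{ite}\ e\,?\,l_1:l_2$; $\mathtt{goto}\ e$; $\mathtt{goto}\ l$; $\mathtt{halt}$. A program $P$ is a map from locations to instructions. **Concrete semantics.** A concrete configuration is $c=(l,r,m)$, with $l\in Loc$ the current location, $r$ a register map from variables to bitvector values, and $m:BV_{32}\to BV_8$ the memory. An initial configuration is $(l_0,r_0,m_0)$ with $l_0$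 the entrypoint of $P$ and $r_0,m_0$ arbitrary. Leakages are finite sequences, $\cdot$ is concatenation. Evaluation $c\ e\vdash_t bv$ (value $bv$, leakage $t$; the leakage is omitted when irrelevant): a constant evaluates to itself and $v$ to $r(v)$, with empty leakage; operators are applied to the operand values, the leakage being that of the operands; if $c\ e\vdash_t bv$ then $c\ @e\vdash_{t\cdot[bv]} m(bv)$. Steps $c\to_t c'$ from $c=(l,r,m)$, according to $P(l)$: - $\mathtt{goto}\ l'$: to $(l',r,m)$, leakage $[l]$. - $\mathtt{goto}\ e$ with $c\ e\vdash_t bv$, $l'=to\_loc(bv)$: to $(l',r,m)$, leakage $t\cdot[l']$. - $\mathtt{ite}\ e\,?\,l_1:l_2$ with $c\ e\vdash_t bv$: to $(l_1,r,m)$ with leakage $t\cdot[l_1]$ if $bv\neq0$; to $(l_2,r,m)$ with leakage $t\cdot[l_2]$ if $bv=0$. - $v:=e$ with $c\ e\vdash_t bv$: to $(l+1,r[v\mapsto bv],m)$, leakage $t$. - $@e:=e'$ with $c\ e\vdash_t bv$, $c\ e'\vdash_{t'} bv'$: to $(l+1,r,m[bv\mapsto bv'])$, leakage $t'\cdot t\cdot[bv]$. No transition rule is given for $\mathtt{halt}$. $c\to_t^k c'$ denotes $k$ steps, $t$ being the concatenation of the leakages of the individual steps. **Constant-time.** Fix sets $H_{Var}\subseteq Var$ and $H_{mem}\subseteq BV_{32}$ of high (secret) variables and of addresses containing high input in the initial memory; the complements are low. $(l,r,m)\simeq_L(l',r',m')$ (low-equivalence) iff $r(v)=r'(v)$ for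 all low $v$ and $m(a)=m'(a)$ for all low $a$. $P$ is constant-time up to $k$ iff for all initial configurations $c_0\simeq_L c_0'$, if $c_0\to_t^k c_k$ and $c_0'\to_{t'}^k c_k'$ then $t=t'$. $P$ is constant-time if this holds for every $k$. **Symbolic configurations.** Formulas are those of the first-order logic of bitvectors and arrays (with $select$, $store$). A relational formula $\hat\varphi$ is either a simple formula $\langle\varphi\rangle$ or a pair $\langle\varphi_l|\varphi_r\rangle$; $\hat\varphi_{|l},\hat\varphi_{|r}$ are its left/right projections (both equal $\varphi$ for $\langle\varphi\rangle$). A symbolic configuration is $s=(l,\rho,\hat\mu,\pi)$: $l\in Loc$; $\rho$ maps variables to relational formulas; $\hat\mu$ (the symbolic memory) is a pair of arrays from 32-bit addresses to bytes; $\pi$ is a formula (path predicate). A model $M$ assigns concrete values to symbolic variables; $M\models\pi$ means $M$ satisfies $\pi$. $secLeak(\hat\varphi)$ (relative to the current $\pi$) is true if $\hat\varphi$ is simple, or if $\hat\varphi=\langle\varphi_l|\varphi_r\rangle$ and $\pi\wedge(\varphi_l\ne\varphi_r)$ is unsatisfiable; it is false otherwise. **Symbolic semantics.** Evaluation $(\rho,\hat\mu)\ e\vdash\hat\varphi$: a constant $bv$ evaluates to $\langle bv\rangle$; $v$ to $\rho(v)$; for operators, the logical counterpart of the operator is applied to the relational formulas of the operands (simple if these are simple, componentwise otherwise); if $(\rho,\hat\mu)\ e\vdash\hat\phi$ and $secLeak(\hat\phi)$ then $@e$ evaluates to $\langle select(\hat\mu_{|l},\hat\phi_{|l})\,|\,select(\hat\mu_{|r},\hat\phi_{|r})\rangle$.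 Steps $s\rightsquigarrow s'$ from $(l,\rho,\hat\mu,\pi)$, according to $P(l)$: - $\mathtt{goto}\ l'$: to $(l',\rho,\hat\mu,\pi)$. - $\mathtt{goto}\ e$ with $e\vdash\hat\varphi$ and $secLeak(\hat\varphi)$: let $\pi'=\pi\wedge(\hat\varphi_{|l}=\hat\varphi_{|r})$; for any model $M\models\pi'$, with $l'=M(\hat\varphi_{|l})$ (read as a location), to $(l',\rho,\hat\mu,\pi')$ (nondeterministic). - $\mathtt{ite}\ e\,?\,l_1:l_2$ with $e\vdash\hat\varphi$ and $secLeak(\hat\varphi)$: to $(l_1,\rho,\hat\mu,\pi')$ if $\pi'=\pi\wedge(true=\hat\varphi_{|l}=\hat\varphi_{|r})$ is satisfiable; to $(l_2,\rho,\hat\mu,\pi')$ if $\pi'=\pi\wedge(false=\hat\varphi_{|l}=\hat\varphi_{|r})$ is satisfiable (nondeterministic). - $v:=e$ with $e\vdash\hat\varphi$: to $(l+1,\rho[v\mapsto\hat\varphi'],\hat\mu,\pi\wedge(\hat\varphi'_{|l}=\hat\varphi_{|l})\wedge(\hat\varphi'_{|r}=\hat\varphi_{|r}))$, where $\hat\varphi'$ is $\hat\varphi$ if it is in canonical form (a bitvector variable plus a constant offset) and a temporary variable otherwise. - $@e:=e'$ with $e\vdash\hat\varphi$, $e'\vdash\hat\phi$ and $secLeak(\hat\varphi)$: to $(l+1,\rho,\hat\mu',\pi')$ with $\hat\mu'=\langle store(\hat\mu_{|l},\hat\varphi_{|l},\hat\phi_{|l})\,|\,store(\hat\mu_{|r},\hat\varphi_{|r},\hat\phi_{|r})\rangle$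 and $\pi'=\pi\wedge\hat\mu'_{|l}=store(\hat\mu_{|l},\hat\varphi_{|l},\hat\phi_{|l})\wedge\hat\mu'_{|r}=store(\hat\mu_{|r},\hat\varphi_{|r},\hat\phi_{|r})$. No transition rule is given for $\mathtt{halt}$. $\rightsquigarrow^k$ denotes $k$ steps. Standing assumption: $P$ is defined on all locations computed during the symbolic execution, and symbolic execution does not get stuck unless $secLeak$ evaluates to false, i.e. it can only get stuck when an expression $\hat\varphi$ is leaked such that $\neg secLeak(\hat\varphi)$; in that case there is a model $M$ with $M\models\pi\wedge(\hat\varphi_{|l}\neq\hat\varphi_{|r})$. **Initial symbolic configuration.** By default the content of memory and registers is low (the same in both executions); at each address specified as initially containing secret input, a pair $\langle\beta|\beta'\rangle$ of fresh symbolic variables is stored, as by a store instruction. Both executions represented in $s_0$ are low-equivalent. **Concretization relation.** For $p\in\{l,r\}$ and a model $M$, with $c=(l_1,r,m)$ and $s=(l_2,\rho,\hat\mu,\pi)$: $c\approx_p^M s$ holds iff $M\models\pi$, $l_1=l_2$, and for every expression $e$, either the symbolic evaluation of $e$ gets stuck, or $(\rho,\hat\mu)\ e\vdash\hat\varphi$ and ($M(\hat\varphi_{|p})=bv$ iff $c\ e\vdash bv$). In particular $c_0\approx_l^M s_0$ and $c_0'\approx_r^M s_0$ imply $c_0\simeq_L c_0'$.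
   Formalization: The claim fails as stated; the formal version has the symbolic rule for goto e also record the chosen target in the path predicate, assumes to_loc is injective and the two targets of every ite are distinct, and takes ite conditions to be one-bit truth values. *)

(* Defs.v *)
From mathcomp Require Import all_boot.

Set Implicit Arguments.
Unset Strict Implicit.
Unset Printing Implicit Defensive.

(* Bits are listed from the least significant one. *)
Notation BV n := (n.-tuple bool).

(* The truth values, bit false being also the zero of width 1. *)
Definition bit (b : bool) : BV 1 := [tuple b].

Definition bvadd n (a b : BV n) : BV n :=
  let val (x : BV n) := foldr (fun (d : bool) m => d + m.*2) 0 x in
  [tuple odd ((val a + val b) %/ 2 ^ i) | i < n].

Record platform := Platform {
  var : eqType;
  width : var -> nat;
  loc : Type;
  lsucc : loc -> loc;         (* l |-> l + 1 *)
  to_loc : BV 32 -> loc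
}.
Arguments width {p}.
Arguments lsucc {p}.
Arguments to_loc {p}.

(* Expressions are intrinsically typed by their width. An operator is any
   function between bitvectors of the appropriate widths. *)
Inductive expr (A : platform) : nat -> Type :=
| EVar (v : var A) : expr A (width v)
| EConst n (b : BV n) : expr A n
| ELoad (e : expr A 32) : expr A 8
| EUn n m (op : BV n -> BV m) (e : expr A n) : expr A m
| EBin n1 n2 m (op : BV n1 -> BV n2 -> BV m) (e1 : expr A n1) (e2 : expr A n2) :
    expr A m.
Arguments EVar {A}.
Arguments EConst {A n}.
Arguments ELoad {A}.
Arguments EUn {A n m}.
Arguments EBin {A n1 n2 m}.

(* A condition is a truth value, hence of width 1. *)
Inductive instr (A : platform) : Type :=
| IAssign (v : var A) (e : expr A (width v))
| IStore (e : expr A 32) (e' : expr A 8)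
| IIte (e : expr A 1) (l1 l2 : loc A)
| IGotoExpr (e : expr A 32)
| IGoto (l : loc A)
| IHalt.
Arguments IHalt {A}.

Record program (A : platform) := Program {
  entry : loc A;
  code : loc A -> option (instr A)
}.

Record cconf (A : platform) := CConf {
  cloc : loc A;
  creg : forall v : var A, BV (width v);
  cmem : BV 32 -> BV 8
}.

Inductive leak (A : platform) : Type :=
| LLoc (l : loc A)
| LAddr (b : BV 32).
Arguments LAddr {A}.

Definition leakage (A : platform) := seq (leak A).

Inductive ceval (A : platform) (c : cconf A) :
    forall n, expr A n -> leakage A -> BV n -> Prop :=
| CEVar v : ceval c (EVar v) [::] (creg c v)
| CEConst n (b : BV n) : ceval c (EConst b) [::] b
| CELoad e t b : ceval c e t b ->
    ceval c (ELoad e) (t ++ [:: LAddr b]) (cmem c b)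
| CEUn n m (op : BV n -> BV m) e t b : ceval c e t b ->
    ceval c (EUn op e) t (op b)
| CEBin n1 n2 m (op : BV n1 -> BV n2 -> BV m) e1 e2 t1 t2 b1 b2 :
    ceval c e1 t1 b1 -> ceval c e2 t2 b2 ->
    ceval c (EBin op e1 e2) (t1 ++ t2) (op b1 b2).

Definition mem_write (m : BV 32 -> BV 8) (a : BV 32) (b : BV 8) : BV 32 -> BV 8 :=
  fun x => if x == a then b else m x.

Inductive cstep (A : platform) (P : program A) :
    cconf A -> leakage A -> cconf A -> Prop :=
| CGoto l r m l' : code P l = Some (IGoto l') ->
    cstep P (CConf l r m) [:: LLoc l'] (CConf l' r m)
| CGotoExpr l r m e t b : code P l = Some (IGotoExpr e) ->
    ceval (CConf l r m) e t b ->
    cstep P (CConf l r m) (t ++ [:: LLoc (to_loc b)]) (CConf (to_loc b) r m)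
| CIteTrue l r m e l1 l2 t b : code P l = Some (IIte e l1 l2) ->
    ceval (CConf l r m) e t b -> b <> bit false ->
    cstep P (CConf l r m) (t ++ [:: LLoc l1]) (CConf l1 r m)
| CIteFalse l r m e l1 l2 t b : code P l = Some (IIte e l1 l2) ->
    ceval (CConf l r m) e t b -> b = bit false ->
    cstep P (CConf l r m) (t ++ [:: LLoc l2]) (CConf l2 r m)
| CAssign l r m v e t b : code P l = Some (@IAssign A v e) ->
    ceval (CConf l r m) e t b ->
    cstep P (CConf l r m) t (CConf (lsucc l) (dfwith r b) m)
| CStore l r m e e' t t' b b' : code P l = Some (IStore e e') ->
    ceval (CConf l r m) e t b -> ceval (CConf l r m) e' t' b' ->
    cstep P (CConf l r m) (t' ++ t ++ [:: LAddr b])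
      (CConf (lsucc l) r (mem_write m b b')).

Inductive csteps (A : platform) (P : program A) :
    nat -> cconf A -> leakage A -> cconf A -> Prop :=
| CSteps0 c : csteps P 0 c [::] c
| CStepsS k c t c' t' c'' : cstep P c t c' -> csteps P k c' t' c'' ->
    csteps P k.+1 c (t ++ t') c''.

(* Registers and memory are arbitrary. *)
Definition cinitial (A : platform) (P : program A) (c : cconf A) : Prop :=
  cloc c = entry P.

(* Locations are not compared. *)
Definition low_equiv (A : platform) (Hvar : {pred var A}) (Hmem : {pred BV 32})
    (c c' : cconf A) : Prop :=
  (forall v, v \notin Hvar -> creg c v = creg c' v) /\
  (forall a, a \notin Hmem -> cmem c a = cmem c' a).

Definition constant_time_upto (A : platform) (P : program A)
    (Hvar : {pred var A}) (Hmem : {pred BV 32}) (k : nat) : Prop :=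
  forall c0 c0' t t' ck ck',
    cinitial P c0 -> cinitial P c0' -> low_equiv Hvar Hmem c0 c0' ->
    csteps P k c0 t ck -> csteps P k c0' t' ck' -> t = t'.

Definition constant_time (A : platform) (P : program A)
    (Hvar : {pred var A}) (Hmem : {pred BV 32}) : Prop :=
  forall k, constant_time_upto P Hvar Hmem k.

Inductive tsort := SBV (n : nat) | SArr.

Definition dom (s : tsort) : Type :=
  match s with SBV n => BV n | SArr => BV 32 -> BV 8 end.

(* Names of symbolic variables: the inputs of the initial configuration
   (low registers, the two sides of a high register, the initial array, the two
   sides of a high memory cell), and a supply of temporaries. *)
Inductive svar (A : platform) : Type :=
| VReg (v : var A)
| VRegL (v : var A)
| VRegR (v : var A)
| VMem
| VMemL (a : BV 32)
| VMemR (a : BV 32)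
| VTmp (i : nat).
Arguments VMem {A}.
Arguments VMemL {A}.
Arguments VMemR {A}.
Arguments VTmp {A}.

Inductive term (A : platform) : tsort -> Type :=
| TVar s (x : svar A) : term A s
| TConst n (b : BV n) : term A (SBV n)
| TUn n m (op : BV n -> BV m) (t : term A (SBV n)) : term A (SBV m)
| TBin n1 n2 m (op : BV n1 -> BV n2 -> BV m)
    (t1 : term A (SBV n1)) (t2 : term A (SBV n2)) : term A (SBV m)
| TSelect (a : term A SArr) (i : term A (SBV 32)) : term A (SBV 8)
| TStore (a : term A SArr) (i : term A (SBV 32)) (b : term A (SBV 8)) :
    term A SArr.
Arguments TVar {A}.
Arguments TConst {A n}.
Arguments TUn {A n m}.
Arguments TBin {A n1 n2 m}.

Inductive form (A : platform) : Type :=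
| FTrue
| FNot (f : form A)
| FAnd (f g : form A)
| FEq s (t u : term A s).
Arguments FTrue {A}.

Definition model (A : platform) := forall s : tsort, svar A -> dom s.

Fixpoint denote (A : platform) (M : model A) s (t : term A s) : dom s :=
  match t in term _ s return dom s with
  | TVar s x => M s x
  | TConst _ b => b
  | TUn _ _ op t => op (denote M t)
  | TBin _ _ _ op t1 t2 => op (denote M t1) (denote M t2)
  | TSelect a i => (denote M a : dom SArr) (denote M i)
  | TStore a i b => mem_write (denote M a) (denote M i) (denote M b)
  end.

Fixpoint models (A : platform) (M : model A) (f : form A) : Prop :=
  match f with
  | FTrue => True
  | FNot f => ~ models M f
  | FAnd f g => models M f /\ models M g
  | FEq _ t u => denote M t = denote M u
  end.

Definition satisfiable (A : platform) (f : form A) : Prop :=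
  exists M : model A, models M f.

Fixpoint occurs (A : platform) (x : svar A) s (t : term A s) : Prop :=
  match t with
  | TVar _ y => x = y
  | TConst _ _ => False
  | TUn _ _ _ t => occurs x t
  | TBin _ _ _ _ t1 t2 => occurs x t1 \/ occurs x t2
  | TSelect a i => occurs x a \/ occurs x i
  | TStore a i b => occurs x a \/ occurs x i \/ occurs x b
  end.

Fixpoint occursF (A : platform) (x : svar A) (f : form A) : Prop :=
  match f with
  | FTrue => False
  | FNot f => occursF x f
  | FAnd f g => occursF x f \/ occursF x g
  | FEq _ t u => occurs x t \/ occurs x u
  end.

Inductive side := Lside | Rside.

Inductive relf (A : platform) (n : nat) : Type :=
| Simple (t : term A (SBV n))
| Pair (tl tr : term A (SBV n)).

Definition proj (A : platform) n (p : side) (f : relf A n) : term A (SBV n) :=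
  match f, p with
  | Simple t, _ => t
  | Pair t _, Lside => t
  | Pair _ t, Rside => t
  end.

Definition rel_un (A : platform) n m (op : BV n -> BV m) (f : relf A n) :
    relf A m :=
  match f with
  | Simple t => Simple (TUn op t)
  | Pair tl tr => Pair (TUn op tl) (TUn op tr)
  end.

Definition rel_bin (A : platform) n1 n2 m (op : BV n1 -> BV n2 -> BV m)
    (f : relf A n1) (g : relf A n2) : relf A m :=
  match f, g with
  | Simple t, Simple u => Simple (TBin op t u)
  | _, _ => Pair (TBin op (proj Lside f) (proj Lside g))
                 (TBin op (proj Rside f) (proj Rside g))
  end.

Definition secLeak (A : platform) (pi : form A) n (f : relf A n) : Prop :=
  match f with
  | Simple _ => True
  | Pair tl tr => ~ satisfiable (FAnd pi (FNot (FEq tl tr)))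
  end.

Inductive canonicalT (A : platform) n : term A (SBV n) -> Prop :=
| CanVar x : canonicalT (TVar (SBV n) x)
| CanOff x (b : BV n) :
    canonicalT (TBin (@bvadd n) (TVar (SBV n) x) (TConst b)).

Definition canonical (A : platform) n (f : relf A n) : Prop :=
  canonicalT (proj Lside f) /\ canonicalT (proj Rside f).

Record smem (A : platform) := SMem { arrL : term A SArr; arrR : term A SArr }.

Definition arr (A : platform) (p : side) (mu : smem A) : term A SArr :=
  match p with Lside => arrL mu | Rside => arrR mu end.

Record sconf (A : platform) := SConf {
  sloc : loc A;
  srho : forall v : var A, relf A (width v);
  smu : smem A;
  spi : form A
}.

Definition fresh (A : platform) (s : sconf A) (x : svar A) : Prop :=
  [/\ forall v p, ~ occurs x (proj p (srho s v)),
      forall p, ~ occurs x (arr p (smu s)) &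
      ~ occursF x (spi s)].

(* [named s f f'] : in the configuration s, f' is what a register assigned the
   value f is mapped to. *)
Inductive named (A : platform) (s : sconf A) n : relf A n -> relf A n -> Prop :=
| NamedCanonical f : canonical f -> named s f f
| NamedSimple t i : ~ canonical (Simple t) -> fresh s (VTmp i) ->
    named s (Simple t) (Simple (TVar (SBV n) (VTmp i)))
| NamedPair tl tr i j : ~ canonical (Pair tl tr) ->
    fresh s (VTmp i) -> fresh s (VTmp j) -> i <> j ->
    named s (Pair tl tr)
      (Pair (TVar (SBV n) (VTmp i)) (TVar (SBV n) (VTmp j))).

Inductive seval (A : platform) (s : sconf A) :
    forall n, expr A n -> relf A n -> Prop :=
| SEVar v : seval s (EVar v) (srho s v)
| SEConst n (b : BV n) : seval s (EConst b) (Simple (TConst b))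
| SELoad e f : seval s e f -> secLeak (spi s) f ->
    seval s (ELoad e) (Pair (TSelect (arr Lside (smu s)) (proj Lside f))
                            (TSelect (arr Rside (smu s)) (proj Rside f)))
| SEUn n m (op : BV n -> BV m) e f : seval s e f ->
    seval s (EUn op e) (rel_un op f)
| SEBin n1 n2 m (op : BV n1 -> BV n2 -> BV m) e1 e2 f1 f2 :
    seval s e1 f1 -> seval s e2 f2 ->
    seval s (EBin op e1 e2) (rel_bin op f1 f2).

Definition sym_store (A : platform) (s : sconf A) (f : relf A 32)
    (g : relf A 8) (l : loc A) : sconf A :=
  let st p := TStore (arr p (smu s)) (proj p f) (proj p g) in
  let mu' := SMem (st Lside) (st Rside) in
  SConf l (srho s) mu'
    (FAnd (FAnd (spi s) (FEq (arr Lside mu') (st Lside)))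
          (FEq (arr Rside mu') (st Rside))).

Inductive sstep (A : platform) (P : program A) : sconf A -> sconf A -> Prop :=
| SGoto l rho mu pi l' : code P l = Some (IGoto l') ->
    sstep P (SConf l rho mu pi) (SConf l' rho mu pi)
(* The new path predicate reads pi /\ (b = f_l = f_r): it records the target b
   that is picked, as SIte records the branch. With f_l = f_r alone, a model of
   it could send the concrete executions to another target. *)
| SGotoExpr l rho mu pi e f (M : model A) b :
    code P l = Some (IGotoExpr e) ->
    seval (SConf l rho mu pi) e f -> secLeak pi f ->
    models M (FAnd pi (FEq (proj Lside f) (proj Rside f))) ->
    b = denote M (proj Lside f) ->
    sstep P (SConf l rho mu pi)
      (SConf (to_loc b) rho mu
        (FAnd (FAnd pi (FEq (TConst b) (proj Lside f)))
              (FEq (proj Lside f) (proj Rside f))))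
(* pi /\ (d = f_l = f_r), with d the truth value selecting the branch *)
| SIte l rho mu pi e l1 l2 f (d : bool) :
    code P l = Some (IIte e l1 l2) ->
    seval (SConf l rho mu pi) e f -> secLeak pi f ->
    let pi' := FAnd (FAnd pi (FEq (TConst (bit d)) (proj Lside f)))
                    (FEq (proj Lside f) (proj Rside f)) in
    satisfiable pi' ->
    sstep P (SConf l rho mu pi) (SConf (if d then l1 else l2) rho mu pi')
| SAssign l rho mu pi v e f f' :
    code P l = Some (@IAssign A v e) ->
    seval (SConf l rho mu pi) e f ->
    named (SConf l rho mu pi) f f' ->
    sstep P (SConf l rho mu pi)
      (SConf (lsucc l) (dfwith rho f') mu
        (FAnd (FAnd pi (FEq (proj Lside f') (proj Lside f)))
              (FEq (proj Rside f') (proj Rside f))))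
| SStore l rho mu pi e e' f g :
    code P l = Some (IStore e e') ->
    seval (SConf l rho mu pi) e f ->
    seval (SConf l rho mu pi) e' g ->
    secLeak pi f ->
    sstep P (SConf l rho mu pi)
      (sym_store (SConf l rho mu pi) f g (lsucc l)).

Inductive ssteps (A : platform) (P : program A) :
    nat -> sconf A -> sconf A -> Prop :=
| SSteps0 s : ssteps P 0 s s
| SStepsS k s s' s'' : sstep P s s' -> ssteps P k s' s'' ->
    ssteps P k.+1 s s''.

(* A configuration at a halt instruction has terminated; it is not stuck. *)
Definition stuck (A : platform) (P : program A) (s : sconf A) : Prop :=
  code P (sloc s) <> Some IHalt /\ ~ exists s', sstep P s s'.

Inductive reads (A : platform) : forall n, expr A n -> expr A 32 -> Prop :=
| ReadHere a : reads (ELoad a) a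
| ReadLoad e a : reads e a -> reads (ELoad e) a
| ReadUn n m (op : BV n -> BV m) e a : reads e a -> reads (EUn op e) a
| ReadBinL n1 n2 m (op : BV n1 -> BV n2 -> BV m) e1 e2 a :
    reads e1 a -> reads (EBin op e1 e2) a
| ReadBinR n1 n2 m (op : BV n1 -> BV n2 -> BV m) e1 e2 a :
    reads e2 a -> reads (EBin op e1 e2) a.

Inductive evaluates (A : platform) : instr A -> forall n, expr A n -> Prop :=
| EvAssign v (e : expr A (width v)) : evaluates (IAssign e) e
| EvStoreAddr e e' : evaluates (IStore e e') e
| EvStoreVal e e' : evaluates (IStore e e') e'
| EvIte e l1 l2 : evaluates (IIte e l1 l2) e
| EvGoto e : evaluates (IGotoExpr e) e.

Inductive leaks (A : platform) : instr A -> forall n, expr A n -> Prop :=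
| LeakGoto e : leaks (IGotoExpr e) e
| LeakIte e l1 l2 : leaks (IIte e l1 l2) e
| LeakStore e e' : leaks (IStore e e') e
| LeakRead i n (e : expr A n) a : evaluates i e -> reads e a -> leaks i a.

(* ~ secLeak forces f to be a pair and (classically) gives a model of
   pi /\ f_l <> f_r. *)
Definition insecure_leak (A : platform) (P : program A) (s : sconf A) : Prop :=
  exists i n (e : expr A n) f,
    [/\ code P (sloc s) = Some i, leaks i e, seval s e f & ~ secLeak (spi s) f].

Definition sym_exec_ok (A : platform) (P : program A) (s0 : sconf A) : Prop :=
  forall k s, ssteps P k s0 s ->
    code P (sloc s) <> None /\ (stuck P s -> insecure_leak P s).

Definition init_rho (A : platform) (Hvar : {pred var A}) (v : var A) :
    relf A (width v) :=
  if v \in Hvar then Pair (TVar (SBV (width v)) (VRegL v))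
                          (TVar (SBV (width v)) (VRegR v))
  else Simple (TVar (SBV (width v)) (VReg v)).

Definition init_secret (A : platform) (s : sconf A) (a : BV 32) : sconf A :=
  sym_store s (Simple (TConst a))
    (Pair (TVar (SBV 8) (VMemL a)) (TVar (SBV 8) (VMemR a))) (sloc s).

(* The pair of fresh variables of each secret address is put in memory as a
   store instruction would do, in any order. *)
Definition sinitial (A : platform) (P : program A) (Hvar : {pred var A})
    (Hmem : {pred BV 32}) (s : sconf A) : Prop :=
  exists addrs : seq (BV 32),
    [/\ uniq addrs, addrs =i Hmem &
        s = foldl (@init_secret A)
              (SConf (entry P) (init_rho Hvar)
                 (SMem (TVar SArr VMem) (TVar SArr VMem)) FTrue)
              addrs].

Definition approx (A : platform) (p : side) (M : model A)
    (c : cconf A) (s : sconf A) : Prop :=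
  [/\ models M (spi s),
      cloc c = sloc s &
      forall n (e : expr A n),
        ~ (exists f, seval s e f) \/
        exists2 f, seval s e f &
          forall b : BV n, denote M (proj p f) = b <-> exists t, ceval c e t b].

(* ite e ? l : l leaks nothing through its target, although the symbolic
   execution still requires secLeak for e. *)
Definition proper_branches (A : platform) (P : program A) : Prop :=
  forall l e l1 l2, code P l = Some (IIte e l1 l2) -> l1 <> l2.

(* Main.v *)
Require Import Defs.
From mathcomp Require Import all_boot.
From Stdlib Require Import Classical.

(** Path predicates only grow along a symbolic run, so a model [M] of the last
    path predicate together with [f_l <> f_r], where [f] is the insecurely leaked
    value, satisfies all of them. Evaluating registers and memory under [M] turns
    the symbolic run into two concrete runs, one per side, which follow the same
    control flow and hence produce leakages of equal length at each step. In the
    stuck configuration both sides execute the same instruction, and their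
    leakages differ at the position where [f] is leaked. *)

Set Implicit Arguments.
Unset Strict Implicit.
Unset Printing Implicit Defensive.

(** Used to compare the leakages of the two sides segment by segment: when preceding segments have
    equal lengths, a difference in one segment survives concatenation. *)
Lemma cat_inj_size T (s s' t t' : seq T) :
  size s = size s' -> s ++ t = s' ++ t' -> s = s' /\ t = t'.
Proof.
elim: s s' => [|x s IH] [|x' s'] //= [/IH{}IH] [-> /IH [-> ->]]; by split.
Qed.

Lemma bv1_bit (b : BV 1) : exists d, b = bit d.
Proof. by case/tupleP: b => d b; exists d; rewrite (tuple0 b); apply: val_inj. Qed.

(** * Concrete semantics as total functions *)

Section Concrete.

Context {A : platform}.
Implicit Types c : cconf A.

(** Expressions are typed and registers and memory are total, so every expression has exactly one
    value and the relation [ceval] can be traded for functions. *)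
Fixpoint cval c n (e : expr A n) : BV n :=
  match e in expr _ n return BV n with
  | EVar v => creg c v
  | EConst _ b => b
  | ELoad e => cmem c (cval c e)
  | EUn _ _ op e => op (cval c e)
  | EBin _ _ _ op e1 e2 => op (cval c e1) (cval c e2)
  end.

Fixpoint cleak c n (e : expr A n) : leakage A :=
  match e with
  | EVar _ | EConst _ _ => [::]
  | ELoad e => cleak c e ++ [:: LAddr (cval c e)]
  | EUn _ _ _ e => cleak c e
  | EBin _ _ _ _ e1 e2 => cleak c e1 ++ cleak c e2
  end.

Lemma ceval_total c n (e : expr A n) : ceval c e (cleak c e) (cval c e).
Proof. by elim: e => *; constructor. Qed.

Lemma ceval_cval c n (e : expr A n) t b : ceval c e t b -> b = cval c e.
Proof. by elim=> {n e t b} //= *; subst. Qed.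

(** The number of reads depends on the syntax of [e] alone. *)
Lemma size_cleak c c' n (e : expr A n) : size (cleak c e) = size (cleak c' e).
Proof. by elim: e => //= *; rewrite !size_cat; congr addn. Qed.

(** A given read puts its address at the same position of both leakages, since what is leaked before
    it has the same length in [c] and [c']. *)
Lemma reads_cleak c c' n (e : expr A n) a : reads e a ->
  cval c a <> cval c' a -> cleak c e <> cleak c' e.
Proof.
elim=> {n e a} [a|e a _ IH|n m op e a _ IH|n1 n2 m op e1 e2 a _ IH|
    n1 n2 m op e1 e2 a _ IH] neq //=; try by exact: IH.
- by case/(cat_inj_size (size_cleak c c' a))=> _ [].
- by case/(cat_inj_size (size_cleak c c' e))=> /IH.
- by case/(cat_inj_size (size_cleak c c' e1))=> /IH.
- by case/(cat_inj_size (size_cleak c c' e1))=> _ /IH.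
Qed.

(** At [IHalt], where no step exists, this function and [cnext] take default values. *)
Definition ileak c (i : instr A) : leakage A :=
  match i with
  | IAssign v e => cleak c e
  | IStore e e' => cleak c e' ++ cleak c e ++ [:: LAddr (cval c e)]
  | IIte e l1 l2 =>
      cleak c e ++ [:: LLoc (if cval c e == bit false then l2 else l1)]
  | IGotoExpr e => cleak c e ++ [:: LLoc (to_loc (cval c e))]
  | IGoto l => [:: LLoc l]
  | IHalt => [::]
  end.

Definition cnext c (i : instr A) : cconf A :=
  match i with
  | IAssign v e => CConf (lsucc (cloc c)) (dfwith (creg c) (cval c e)) (cmem c)
  | IStore e e' => CConf (lsucc (cloc c)) (creg c)
                     (mem_write (cmem c) (cval c e) (cval c e'))
  | IIte e l1 l2 =>
      CConf (if cval c e == bit false then l2 else l1) (creg c) (cmem c)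
  | IGotoExpr e => CConf (to_loc (cval c e)) (creg c) (cmem c)
  | IGoto l => CConf l (creg c) (cmem c)
  | IHalt => c
  end.

Lemma size_ileak c c' i : size (ileak c i) = size (ileak c' i).
Proof. by case: i => * //=; rewrite ?size_cat ?(size_cleak c c'). Qed.

Lemma cstep_cnext (P : program A) c i :
  code P (cloc c) = Some i -> i <> IHalt -> cstep P c (ileak c i) (cnext c i).
Proof.
case: c => l r m /=; case: i => //= [v e|e e'|e l1 l2|e|l'] Pl _.
- by apply: CAssign Pl _; apply: ceval_total.
- by apply: CStore Pl _ _; apply: ceval_total.
- have ev := ceval_total (CConf l r m) e.
  by case: eqP => d; [apply: CIteFalse Pl ev d | apply: CIteTrue Pl ev d].
- by apply: CGotoExpr Pl _; apply: ceval_total.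
- exact: CGoto.
Qed.

Lemma csteps_rcons (P : program A) k c t c' u c'' :
  csteps P k c t c' -> cstep P c' u c'' -> csteps P k.+1 c (t ++ u) c''.
Proof.
move=> run; elim: run u c'' => {k c t c'} [c|k c t c1 t' c2 st _ IH] u c'' st'.
  by rewrite -[[::] ++ u]cats0 /=; apply: CStepsS st' (CSteps0 _ _).
by rewrite -catA; apply: CStepsS st (IH _ _ st').
Qed.

Lemma leaks_not_halt i n (e : expr A n) : leaks i e -> i <> IHalt.
Proof. by case=> // {}i {}n {}e a []. Qed.

(** The leakage determines the leaked value: a computed target does so by injectivity of [to_loc], a
    branch target because the two branches are distinct, and an address appears as itself. *)
Lemma leaks_ileak (P : program A) c c' l i n (e : expr A n) :
  injective (@to_loc A) -> proper_branches P -> code P l = Some i ->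
  leaks i e -> cval c e <> cval c' e -> ileak c i <> ileak c' i.
Proof.
move=> inj branches Pl lk; case: lk Pl => {i n e}.
- move=> e _ neq /=.
  by case/(cat_inj_size (size_cleak c c' e))=> _ [/inj].
- move=> e l1 l2 Pl neq /=.
  case/(cat_inj_size (size_cleak c c' e))=> _ []; move: neq.
  (* Two distinct conditions of width 1 are the two truth values, so one side goes to [l1] and the
     other to [l2]. *)
  have [d ->] := bv1_bit (cval c e); have [d' ->] := bv1_bit (cval c' e).
  have neq := branches _ _ _ _ Pl.
  by case: d d' => [] [] //= _ eq_l; apply: neq.
- move=> e e' _ neq /=.
  case/(cat_inj_size (size_cleak c c' e'))=> _.
  by case/(cat_inj_size (size_cleak c c' e))=> _ [].
- move=> i n e a ev rd _ neq; have := reads_cleak rd neq.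
  case: ev {rd} => {i n e} //=.
  + move=> e e' neq_e; case/(cat_inj_size (size_cleak c c' e'))=> _.
    by case/(cat_inj_size (size_cleak c c' e)).
  + by move=> e e' neq_e; case/(cat_inj_size (size_cleak c c' e')).
  + by move=> e l1 l2 neq_e; case/(cat_inj_size (size_cleak c c' e)).
  + by move=> e neq_e; case/(cat_inj_size (size_cleak c c' e)).
Qed.

End Concrete.

(** * Simulation of a symbolic run by two concrete runs *)

Section Simulation.

Context {A : platform}.
Implicit Types (M : model A) (p : side) (c : cconf A) (s : sconf A).

(** The simulation invariant. Unlike [approx], it involves neither the path predicate nor
    expressions whose evaluation gets stuck. *)
Definition instance M p c s : Prop :=
  [/\ cloc c = sloc s,
      forall v, creg c v = denote M (proj p (srho s v)) &
      cmem c =1 denote M (arr p (smu s))].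

Definition concretize M p s : cconf A :=
  CConf (sloc s) (fun v => denote M (proj p (srho s v)))
    (denote M (arr p (smu s))).

Lemma instance_concretize M p s : instance M p (concretize M p s) s.
Proof. by []. Qed.

Lemma denote_rel_un M p n m (op : BV n -> BV m) (f : relf A n) :
  denote M (proj p (rel_un op f)) = op (denote M (proj p f)).
Proof. by case: f p => [t|tl tr] []. Qed.

Lemma denote_rel_bin M p n1 n2 m (op : BV n1 -> BV n2 -> BV m)
    (f : relf A n1) (g : relf A n2) :
  denote M (proj p (rel_bin op f g)) =
  op (denote M (proj p f)) (denote M (proj p g)).
Proof. by case: f g p => [t|tl tr] [u|ul ur] []. Qed.

Lemma seval_cval M p c s n (e : expr A n) f :
  instance M p c s -> seval s e f -> denote M (proj p f) = cval c e.
Proof.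
case=> _ regs mem; elim=> {n e f} //=.
- by move=> e f _ IH _; case: p regs mem IH => regs mem IH /=; rewrite mem IH.
- by move=> n m op e f _ IH; rewrite denote_rel_un IH.
- by move=> n1 n2 m op e1 e2 f1 f2 _ IH1 _ IH2; rewrite denote_rel_bin IH1 IH2.
Qed.

Lemma instance_approx M p c s :
  models M (spi s) -> instance M p c s -> approx p M c s.
Proof.
move=> Mpi cs; split=> //; first by case: cs.
(* Excluded middle decides whether the symbolic evaluation of [e] gets stuck. *)
move=> n e; have [[f ef]|] := classic (exists f, seval s e f); last by left.
right; exists f => // b; rewrite (seval_cval cs ef); split=> [<-|[t]].
  by exists (cleak c e); apply: ceval_total.
by move/ceval_cval.
Qed.

Lemma sstep_models (P : program A) M s s' :
  sstep P s s' -> models M (spi s') -> models M (spi s).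
Proof. by case=> * //; simpl in *; tauto. Qed.

Lemma ssteps_models (P : program A) M k s s' :
  ssteps P k s s' -> models M (spi s') -> models M (spi s).
Proof.
by elim=> {k s s'} // k s s1 s2 st _ IH /IH; apply: sstep_models st.
Qed.

Lemma instance_sym_store M p c s (f : relf A 32) (g : relf A 8) l :
  instance M p c s ->
  instance M p
    (CConf l (creg c)
       (mem_write (cmem c) (denote M (proj p f)) (denote M (proj p g))))
    (sym_store s f g l).
Proof.
case=> _ regs mem; split=> //= a; rewrite /mem_write mem.
by case: p {regs mem}.
Qed.

(** The path predicate of [s'] forces the concrete step to the location of [s']. Choosing [i] before
    [p] and [c] makes both sides execute the same instruction. *)
Lemma sstep_simulation (P : program A) M s s' :
  sstep P s s' -> models M (spi s') ->
  exists i, [/\ code P (sloc s) = Some i, i <> IHalt &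
    forall p c, instance M p c s -> instance M p (cnext c i) s'].
Proof.
case=> {s s'} /=.
- move=> l rho mu pi l' Pl _; exists (IGoto l'); split=> // p c [].
  by split.
- move=> l rho mu pi e f M' b Pl ef _ _ _ [[_ bL] LR].
  exists (IGotoExpr e); split=> // p c cs; have := seval_cval cs ef.
  case: cs => _ regs mem; move=> val; split=> //=; congr to_loc.
  (* [bL] gives the left side the recorded target, and [LR] transfers it to the right side. *)
  by rewrite -val; case: p {regs mem val}; rewrite -?LR -bL.
- move=> l rho mu pi e l1 l2 f d Pl ef _ _ [[_ bL] LR].
  exists (IIte e l1 l2); split=> // p c cs; have := seval_cval cs ef.
  case: cs => _ regs mem; move=> val; split=> //=.
  have <- : bit d = cval c e.
    by rewrite -val; case: p {regs mem val}; rewrite -?LR -bL.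
  by case: d {bL}.
- move=> l rho mu pi v e f f' Pl ef _ [[_ eqL] eqR].
  exists (IAssign e); split=> // p c cs; have := seval_cval cs ef.
  case: cs => /= eql regs mem val; split=> //=; first by rewrite eql.
  move=> w; have [->|neq] := eqVneq w v.
    (* The register holds [f'], possibly a temporary; [eqL] and [eqR] make [M] interpret it as the
       value [f] on each side. *)
    by rewrite !dfwith_in -val; case: p {regs mem val}.
  by rewrite !dfwith_out // eq_sym.
- move=> l rho mu pi e e' f g Pl ef eg _ _.
  exists (IStore e e'); split=> // p c cs.
  have := instance_sym_store f g (lsucc l) cs.
  rewrite (seval_cval cs ef) (seval_cval cs eg).
  by case: (cs) => /= -> _ _.
Qed.

(** Both runs are built in one induction, because equality of the sizes relies on each step
    executing a common instruction. *)
Lemma ssteps_simulation (P : program A) M k s s' :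
  ssteps P k s s' -> models M (spi s') ->
  forall c c', instance M Lside c s -> instance M Rside c' s ->
  exists ck ck' t t',
    [/\ instance M Lside ck s', instance M Rside ck' s',
        csteps P k c t ck, csteps P k c' t' ck' & size t = size t'].
Proof.
elim=> {k s s'} [s|k s s1 s2 st run IH] Mpi c c' cs cs'.
  by exists c, c', [::], [::]; split=> //; apply: CSteps0.
have [i [Pl not_halt sim]] := sstep_simulation st (ssteps_models run Mpi).
have [ck [ck' [t [t' [ik ik' runL runR eqt]]]]] :=
  IH Mpi _ _ (sim _ _ cs) (sim _ _ cs').
exists ck, ck', (ileak c i ++ t), (ileak c' i ++ t'); split=> //.
- by apply: CStepsS runL; apply: cstep_cnext => //; case: cs => ->.
- by apply: CStepsS runR; apply: cstep_cnext => //; case: cs' => ->.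
- by rewrite !size_cat eqt (size_ileak c c').
Qed.

(** The store only touches the constant secret address [a], which low-equivalence ignores. *)
Lemma low_equiv_sym_store (Hvar : {pred var A}) (Hmem : {pred BV 32}) M s
    (a : BV 32) (g : relf A 8) l :
  a \in Hmem ->
  low_equiv Hvar Hmem (concretize M Lside s) (concretize M Rside s) ->
  let s' := sym_store s (Simple (TConst a)) g l in
  low_equiv Hvar Hmem (concretize M Lside s') (concretize M Rside s').
Proof.
move=> Ha [regs mem]; split=> //= x Hx; rewrite /mem_write.
by case: eqP => [eqx|_]; [rewrite eqx Ha in Hx | apply: mem].
Qed.

Lemma sinitial_low_equiv (P : program A) (Hvar : {pred var A})
    (Hmem : {pred BV 32}) M s :
  sinitial P Hvar Hmem s ->
  sloc s = entry P /\
  low_equiv Hvar Hmem (concretize M Lside s) (concretize M Rside s).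
Proof.
case=> addrs [_ eqH ->].
(* Inclusion in [Hmem], unlike equality with it, passes to tails of [addrs], as the induction
   requires. *)
have: {subset addrs <= Hmem} by move=> a; rewrite eqH.
set s1 := SConf _ _ _ _.
have: sloc s1 = entry P by [].
have: low_equiv Hvar Hmem (concretize M Lside s1) (concretize M Rside s1).
  by split=> //= v; rewrite /init_rho => /negbTE ->.
elim: addrs s1 {eqH s} => [|a addrs IH] s1 low loc sub //=.
apply: IH => //; last by move=> x x_in; apply: sub; rewrite inE x_in orbT.
by apply: low_equiv_sym_store => //; apply: sub; rewrite inE eqxx.
Qed.

(** A simple formula always satisfies [secLeak], so [f] is a pair, and double negation elimination
    on satisfiability yields the model. *)
Lemma not_secLeak (pi : form A) n (f : relf A n) :
  ~ secLeak pi f ->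
  exists2 M, models M pi & denote M (proj Lside f) <> denote M (proj Rside f).
Proof.
by case: f => [t []|tl tr /NNPP [M [Mpi neq]]] //; exists M.
Qed.

End Simulation.

Theorem theorem4 (A : platform) (P : program A)
    (Hvar : {pred var A}) (Hmem : {pred BV 32})
    (to_loc_inj : injective (@to_loc A))
    (branches : proper_branches P)
    (s0 : sconf A) (init : sinitial P Hvar Hmem s0)
    (exec_ok : sym_exec_ok P s0)
    (k : nat) (sk : sconf A)
    (run : ssteps P k s0 sk) (sk_stuck : stuck P sk) :
  ~ constant_time P Hvar Hmem /\
  exists (M : model A) (c0 c0' ck ck' : cconf A),
    [/\ approx Lside M c0 s0, approx Rside M c0' s0,
        approx Lside M ck sk & approx Rside M ck' sk] /\
    exists (ck1 ck1' : cconf A) (t t' u u' : leakage A),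
      [/\ low_equiv Hvar Hmem c0 c0',
          csteps P k c0 t ck /\ cstep P ck u ck1,
          csteps P k c0' t' ck' /\ cstep P ck' u' ck1' &
          t ++ u <> t' ++ u'].
Proof.
have [i [n [e [f [Pl lk ef /not_secLeak [M Mpi neq]]]]]] :=
  (exec_ok _ _ run).2 sk_stuck.
have [entry0 low] := sinitial_low_equiv M init.
have I0 p := instance_concretize M p s0.
have [ck [ck' [t [t' [ik ik' runL runR eqt]]]]] :=
  ssteps_simulation run Mpi (I0 Lside) (I0 Rside).
have not_halt := leaks_not_halt lk.
have stL : cstep P ck (ileak ck i) (cnext ck i).
  by apply: cstep_cnext => //; case: ik => ->.
have stR : cstep P ck' (ileak ck' i) (cnext ck' i).
  by apply: cstep_cnext => //; case: ik' => ->.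
have neq_t : t ++ ileak ck i <> t' ++ ileak ck' i.
  case/(cat_inj_size eqt)=> _; apply: (leaks_ileak to_loc_inj branches Pl lk).
  by rewrite -(seval_cval ik ef) -(seval_cval ik' ef).
split.
  (* Constant-time is contradicted at [k.+1] steps, by adding the leaking step to each run. *)
  move=> ct; apply: neq_t.
  exact: (ct _ (concretize M Lside s0) (concretize M Rside s0) _ _ _ _
    entry0 entry0 low (csteps_rcons runL stL) (csteps_rcons runR stR)).
have Mpi0 := ssteps_models run Mpi.
exists M, (concretize M Lside s0), (concretize M Rside s0), ck, ck'.
split; first by split; apply: instance_approx.
by exists (cnext ck i), (cnext ck' i), t, t', (ileak ck i), (ileak ck' i).
Qed.
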